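(* Let $G$ be a finite simple graph. Then, as simplicial complexes on the underlying set $V(G)$, \[ \mathcal{D}(G)^\vee = \mathcal{N}(\overline{G}). \]
   Context: A simplicial complex here is a pair of a finite underlying set $S$ and a family $K$ of subsets of $S$ closed under taking subsets (elements $v\in S$ with $\{v\}\notin K$ are allowed, ''ghost vertices''). For $v\in V(G)$, $N_G(v)$ is the set of vertices adjacent to $v$ and $N_G[v]=N_G(v)\cup\{v\}$. A subset $\sigma\subseteq V(G)$ is dominating in $G$ if every vertex of $G$ lies in $\sigma$ or is adjacent to an element of $\sigma$. The dominance complex $\mathcal{D}(G)$ is the simplicial complex with underlying set $V(G)$ whose simplices are the subsets of $V(G)$ whose complements in $V(G)$ are dominating in $G$. The neighborhood complex $\mathcal{N}(H)$ of a graph $H$ is the simplicial complex with underlying set $V(H)$ whose simplices are the subsets of $V(H)$ contained in $N_H(v)$ for some $v\in V(H)$. $\overline{G}$ is the complement graph (same vertex set, $v,w$ distinct are adjacent iff they are not adjacent in $G$). For a simplicial complex $K$ with underlying set $S$, the combinatorial Alexander dual $K^\vee$ is the simplicial complex with underlying set $S$ whose simplices are the subsets $\sigma\subseteq S$ such that $S\setminus\sigma\notin K$. *)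

(* Defs.v *)
From HB Require Import structures.
From mathcomp Require Import all_boot.

Set Implicit Arguments.
Unset Strict Implicit.
Unset Printing Implicit Defensive.

Record simple_graph (V : finType) := SimpleGraph {
  adj :> rel V;
  adj_sym : symmetric adj;
  adj_irr : irreflexive adj
}.

(* The family may be empty, and singletons need not be members
   (ghost vertices). *)
Definition down_closed (S : finType) (K : {set {set S}}) : bool :=
  [forall s in K, forall t : {set S}, (t \subset s) ==> (t \in K)].

(* The closure condition is boolean, hence proof irrelevant: two complexes on S
   are equal as soon as they have the same simplices (val_inj). *)
Record complex (S : finType) := Complex {
  simplices :> {set {set S}};
  simplicesP : down_closed simplices
}.

HB.instance Definition _ (S : finType) := [isSub for @simplices S].

Lemma down_closedP (S : finType) (K : {set {set S}}) :
  reflect (forall s t : {set S}, s \in K -> t \subset s -> t \in K)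
          (down_closed K).
Proof.
apply: (iffP forall_inP) => [h s t /h /forallP/(_ t)/implyP | h s sK].
  exact.
by apply/forallP => t; apply/implyP; apply: h.
Qed.

Section Graphs.
Variables (V : finType) (G : simple_graph V).

Definition nbhd (v : V) : {set V} := [set w | G v w].

Definition dominating (s : {set V}) : bool :=
  [forall v, (v \in s) || [exists w in s, G v w]].

Definition compl_adj : rel V := fun v w => (v != w) && ~~ G v w.

Lemma compl_adj_sym : symmetric compl_adj.
Proof. by move=> v w; rewrite /compl_adj eq_sym adj_sym. Qed.

Lemma compl_adj_irr : irreflexive compl_adj.
Proof. by move=> v; rewrite /compl_adj eqxx. Qed.

Definition compl_graph : simple_graph V :=
  SimpleGraph compl_adj_sym compl_adj_irr.

Lemma dominatingS (s t : {set V}) :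
  s \subset t -> dominating s -> dominating t.
Proof.
move=> /subsetP st /forallP dom; apply/forallP => v.
case/orP: (dom v) => [/st -> // | /exists_inP[w /st wt vw]].
by apply/orP; right; apply/exists_inP; exists w.
Qed.

Lemma dominance_closed : down_closed [set s : {set V} | dominating (~: s)].
Proof.
apply/down_closedP => s t; rewrite !inE => dom ts.
by apply: dominatingS dom; rewrite setCS.
Qed.

Definition dominance_complex : complex V := Complex dominance_closed.

Lemma neighborhood_closed :
  down_closed [set s : {set V} | [exists v, s \subset nbhd v]].
Proof.
apply/down_closedP => s t; rewrite !inE => /existsP[v sv] ts.
by apply/existsP; exists v; apply: subset_trans sv.
Qed.

Definition neighborhood_complex : complex V := Complex neighborhood_closed.

End Graphs.

Section AlexanderDual.
Variables (S : finType) (K : complex S).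

Lemma alexander_dual_closed : down_closed [set s : {set S} | ~: s \notin K].
Proof.
apply/down_closedP => s t; rewrite !inE => sK ts.
apply: contra sK => tK; apply: (down_closedP _ (simplicesP K)) tK _.
by rewrite setCS.
Qed.

Definition alexander_dual : complex S := Complex alexander_dual_closed.

End AlexanderDual.

(* Main.v *)
Require Import Defs.
From mathcomp Require Import all_boot.

(** The complement taken in the dual cancels the one in the dominance complex, so the simplices of
    the dual are the non-dominating sets. A vertex [v] witnesses that [s] is not dominating when it
    is neither in [s] nor adjacent to a member of [s], that is, when every member of [s] is a
    neighbor of [v] in the complement graph. *)

Lemma not_dominatingE (V : finType) (G : simple_graph V) (s : {set V}) :
  ~~ dominating G s = [exists v, s \subset nbhd (compl_graph G) v].
Proof.
rewrite negb_forall; apply: eq_existsb => v.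
rewrite negb_or negb_exists_in; apply/andP/subsetP => [[vs /forall_inP nG] w ws|sN].
  by rewrite inE /= /compl_adj nG // andbT; apply: contraNneq vs => ->.
(* If [v] were in [s], it would be its own neighbor in the complement graph. *)
split; first by apply/negP => /sN; rewrite inE /= /compl_adj eqxx.
by apply/forall_inP => w /sN; rewrite inE => /andP[].
Qed.

Theorem theorem1p1 (V : finType) (G : simple_graph V) :
  alexander_dual (dominance_complex G) = neighborhood_complex (compl_graph G).
Proof.
by apply: val_inj; apply/setP => s; rewrite !inE setCK not_dominatingE.
Qed.
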